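(* Let $V$ be a finite-dimensional vector space over a field $K$ with $n=\dim V\ge2$. Then the map $$\widetilde H_{n-1}(E^*(V))\longrightarrow\widetilde{St}(V),\qquad \partial(0,g_1,\dots,g_n)\mapsto[g_1,\dots,g_n]$$ (for non-zero vectors $g_1,\dots,g_n\in V$) is an isomorphism.
   Context: $E^*(V)$ is the simplicial complex with vertex set $V$ whose simplices are the non-empty finite $X\subset V$ such that $0\in X$ implies $\langle X\rangle\neq V$ ($\langle X\rangle$ is the span). Chains are ordered simplicial chains: $C_p$ is free abelian on tuples $(v_0,\dots,v_p)$ whose entries form a simplex. The extended symbol $\partial(0,g_1,\dots,g_n)$ is the class in $\widetilde H_{n-1}(E^*(V))$ of the cycle $(g_1,\dots,g_n)+\sum_{i=1}^n(-1)^i(0,g_1,\dots,\widehat{g_i},\dots,g_n)$. $T(V)$ is the Tits building: the simplicial complex whose $p$-simplices are flags $V_0<\cdots<V_p$ of subspaces with $0<V_0$, $V_p<V$. The reduced Steinberg module is $\widetilde{St}(V)=H_{n-2}(T(V))$ if $n>2$ and $\widetilde{St}(V)=\ker(H_0(T(V))\to\mathbb Z)$ if $n=2$. Modular symbol: given non-zero $g_1,\dots,g_n\in V$, let $\phi:\partial\,\mathrm{sd}\Delta_{n-1}\to T(V)$ be the simplicial map sending a vertex $v$ (a proper non-empty subset of $\{1,\dots,n\}$) to $\langle g_i: i\in v\rangle$. Then $[g_1,\dots,g_n]=\phi_*(\zeta_{n-1})$, where $\zeta_{n-1}\in \widetilde H_{n-2}(\partial\,\mathrm{sd}\Delta_{n-1})\simeq\mathbb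 Z$ is the fundamental class. *)

(* Defs.v *)
From HB Require Import structures.
From mathcomp Require Import all_boot all_order all_algebra all_fingroup.
From mathcomp Require Import generic_quotient ring_quotient finmap boolp.
From mathcomp Require Import freeg.
From mathcomp Require Import zify.

Set Implicit Arguments.
Unset Strict Implicit.
Unset Printing Implicit Defensive.

Import GRing.Theory.
Local Open Scope ring_scope.

(* The vertices are the v with [fset v] a simplex; they need not exhaust T. *)
Record complex (T : choiceType) := Complex {
  simplex : pred {fset T};
  simplex_neq0 : forall X, simplex X -> X != fset0;
  simplex_sub : forall X Y,
    simplex X -> (Y `<=` X)%fset -> Y != fset0 -> simplex Y
}.

Section FreeAbelian.
Variable K : choiceType.

(* Naming the zmodType keeps the several canonical structures that freeg puts
   on {freeg K / int} from interfering with rewriting. *)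
Definition freeab : zmodType := {freeg K / int}.

Definition gen (k : K) : freeab := << k >>.
Definition coef (k : K) (c : freeab) : int := coeff k c.
Definition supp (c : freeab) : seq K := dom c.

Definition extend (M : zmodType) (f : K -> M) (c : freeab) : M :=
  \sum_(k <- supp c) f k *~ coef k c.

Lemma freeabP (c d : freeab) : (forall k, coef k c = coef k d) -> c = d.
Proof. by move=> cd; apply/eqP/freeg_eqP. Qed.

Lemma coef_gen k l : coef k (gen l) = (l == k)%:R.
Proof. by rewrite /coef coeffU mul1r. Qed.

Lemma coef_is_additive k : additive (coef k).
Proof. exact: coeff_is_additive. Qed.

HB.instance Definition _ k :=
  GRing.isAdditive.Build freeab int (coef k) (coef_is_additive k).

Lemma mem_supp c k : (k \in supp c) = (coef k c != 0).
Proof. exact: mem_dom. Qed.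

Lemma uniq_supp c : uniq (supp c).
Proof. exact: uniq_dom. Qed.

Lemma extend_supp (M : zmodType) (f : K -> M) c (r : seq K) :
  uniq r -> {subset supp c <= r} -> extend f c = \sum_(k <- r) f k *~ coef k c.
Proof.
move=> ur sr; rewrite (bigID (mem (supp c))) /= [X in _ + X]big1 => [|k]; last first.
  by rewrite mem_supp negbK => /eqP->; rewrite mulr0z.
rewrite addr0 -big_filter; apply/perm_big/uniq_perm; rewrite ?uniq_supp ?filter_uniq //.
by move=> k; rewrite mem_filter andbC; case: (boolP (k \in supp c)) => [/sr->|]; rewrite ?andbF.
Qed.

Lemma extend_is_additive (M : zmodType) (f : K -> M) : additive (extend f).
Proof.
move=> c d; pose r := undup (supp (c - d) ++ supp c ++ supp d).
have ur : uniq r by exact: undup_uniq.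
rewrite !(@extend_supp _ f _ r) //; try by move=> k kc; rewrite mem_undup !mem_cat kc ?orbT.
by rewrite -sumrB; apply: eq_bigr => k _; rewrite raddfB mulrzBr.
Qed.

HB.instance Definition _ (M : zmodType) (f : K -> M) :=
  GRing.isAdditive.Build freeab M (extend f) (extend_is_additive f).

Lemma extend_gen (M : zmodType) (f : K -> M) k : extend f (gen k) = f k.
Proof.
by rewrite /extend [supp _]domU1 big_seq1 coef_gen eqxx mulr1z.
Qed.

Lemma freeab_sumE c : c = \sum_(k <- supp c) gen k *~ coef k c.
Proof.
apply: freeabP => l; rewrite raddf_sum /=.
have E k : coef l (gen k *~ coef k c) = (if k == l then coef l c else 0).
  rewrite raddfMz /= coef_gen; case: eqP => [->|_]; last by rewrite mul0rz.
  by rewrite -[RHS]intz.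
rewrite (eq_bigr _ (fun k _ => E k)) -big_mkcond /=.
have [lc|lc] := boolP (l \in supp c).
  by rewrite -big_filter filter_pred1_uniq ?uniq_supp // big_seq1.
rewrite big1_seq => [|k /andP[/eqP-> /idPn[]//]].
by apply/eqP; rewrite -[_ == _]negbK -mem_supp.
Qed.

Lemma freeab_ind (P : freeab -> Prop) :
  (forall k, P (gen k)) -> (forall c d, P c -> P d -> P (c - d)) ->
  P 0 -> forall c, P c.
Proof.
move=> Pg PB P0 c; have PN d : P d -> P (- d) by rewrite -[- d]add0r; apply: PB.
have PD d e : P d -> P e -> P (d + e) by move=> Pd /PN; rewrite -{2}[e]opprK; apply: PB.
rewrite [c]freeab_sumE; apply: big_ind => // k _.
have PM n : P (gen k *+ n) by elim: n => // n IH; rewrite mulrS; apply: PD.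
by case: (coef k c) => n; [apply: PM | apply/PN/PM].
Qed.

End FreeAbelian.

Section Boundary.
Variable T : choiceType.
Implicit Types (s : seq T) (c : freeab (seq T)) (x : T).

Definition face (i : nat) s : seq T := take i s ++ drop i.+1 s.

(* A sequence of length 1 has the empty sequence as boundary, so bd on 0-chains
   is the augmentation, C_(-1) = Z being generated by the empty sequence. *)
Definition bd : freeab (seq T) -> freeab (seq T) :=
  extend (fun s => \sum_(i < size s) gen (face i s) *~ (-1) ^+ i).

HB.instance Definition _ := GRing.Additive.on bd.

Lemma bd_gen s : bd (gen s) = \sum_(i < size s) gen (face i s) *~ (-1) ^+ i.
Proof. exact: extend_gen. Qed.

Definition cone x : freeab (seq T) -> freeab (seq T) :=
  extend (fun s => gen (x :: s)).

HB.instance Definition _ x := GRing.Additive.on (cone x).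

Lemma cone_gen x s : cone x (gen s) = gen (x :: s).
Proof. exact: extend_gen. Qed.

Lemma bd_gen_cons x s : bd (gen (x :: s)) = gen s - cone x (bd (gen s)).
Proof.
rewrite !bd_gen /= big_ord_recl /face /= drop0 mulr1z; congr (_ + _).
rewrite [cone x _]raddf_sum -sumrN; apply: eq_bigr => i _.
by rewrite raddfMz /= cone_gen exprS mulN1r mulrNz.
Qed.

Lemma bd_cone x c : bd (cone x c) = c - cone x (bd c).
Proof.
elim/freeab_ind: c => [s|c d IHc IHd|].
- by rewrite cone_gen bd_gen_cons.
- by rewrite !raddfB /= IHc IHd !opprD !opprK addrACA.
- by rewrite !raddf0 addr0.
Qed.

Lemma bd_bd c : bd (bd c) = 0.
Proof.
elim/freeab_ind: c => [s|c d IHc IHd|]; last by rewrite !raddf0.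
  elim: s => [|x s IH]; first by rewrite bd_gen big_ord0 raddf0.
  by rewrite bd_gen_cons raddfB /= bd_cone IH raddf0 subr0 subrr.
by rewrite !raddfB /= IHc IHd subr0.
Qed.

End Boundary.

Section Homology.
Variables (T : choiceType) (X : complex T) (p : nat).

(* Ordered simplices: repeated entries are allowed. *)
Definition osimplex (s : seq T) : bool :=
  (size s == p.+1) && simplex X [fset x in s]%fset.

Definition chain : {pred freeab (seq T)} :=
  [pred c | all osimplex (supp c)].

Lemma chainP c : reflect (forall s, coef s c != 0 -> osimplex s) (c \in chain).
Proof.
apply: (iffP allP) => h s.
  by rewrite -mem_supp; apply: h.
by rewrite mem_supp; apply: h.
Qed.

Lemma chain_zmod_closed : zmod_closed chain.
Proof.
split=> [|c d /chainP hc /chainP hd]; apply/chainP => s.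
  by rewrite raddf0 eqxx.
rewrite raddfB /= => h; have [c0|] := eqVneq (coef s c) 0; last exact: hc.
by apply: hd; apply: contraNneq h => ->; rewrite c0 subr0.
Qed.

HB.instance Definition _ := GRing.isZmodClosed.Build _ chain chain_zmod_closed.

Lemma chain_gen s : osimplex s -> gen s \in chain.
Proof.
move=> hs; apply/chainP => t; rewrite coef_gen.
by have [<-//|_] := eqVneq s t; rewrite eqxx.
Qed.

Definition is_cycle : {pred freeab (seq T)} :=
  [pred c | (c \in chain) && (bd c == 0)].

Lemma is_cycle_zmod_closed : zmod_closed is_cycle.
Proof.
split=> [|c d /andP[hc /eqP bc] /andP[hd /eqP bd0]]; apply/andP; split.
- exact: rpred0.
- by rewrite raddf0.
- exact: rpredB.
- by rewrite raddfB /= bc bd0 subrr.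
Qed.

HB.instance Definition _ :=
  GRing.isZmodClosed.Build _ is_cycle is_cycle_zmod_closed.

Record cycle := Cycle { cycle_val :> freeab (seq T);
                        cycle_valP : cycle_val \in is_cycle }.

HB.instance Definition _ := [isSub for cycle_val].
HB.instance Definition _ := [Choice of cycle by <:].
HB.instance Definition _ := [SubChoice_isSubZmodule of cycle by <:].

End Homology.

Section ReducedHomology.
Variables (T : choiceType) (X : complex T) (p : nat).

Definition boundary : {pred cycle X p} :=
  [pred z : cycle X p | `[< exists2 d, d \in chain X p.+1 & val z = bd d >]].

Lemma boundary_zmod_closed : zmod_closed boundary.
Proof.
split=> [|y z /asboolP[c hc yc] /asboolP[d hd zd]]; apply/asboolP.
  by exists 0; rewrite ?rpred0 ?raddf0.
by exists (c - d); rewrite ?rpredB // !raddfB /= -yc -zd.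
Qed.

HB.instance Definition _ :=
  GRing.isZmodClosed.Build _ boundary boundary_zmod_closed.

(* Reduced homology in degree p >= 0; see the remark before bd. *)
Definition rhomology : zmodType := Quotient.quot boundary.

Definition hclass (z : cycle X p) : rhomology := \pi_(Quotient.quot boundary)%qT z.

Definition hrepr (x : rhomology) : cycle X p :=
  generic_quotient.repr (x : Quotient.quot boundary).

Lemma hreprK : cancel hrepr hclass.
Proof. exact: reprK. Qed.

Lemma hclassB : {morph hclass : x y / x - y}.
Proof. exact: raddfB. Qed.

Lemma hclass_eq (y z : cycle X p) :
  hclass y = hclass z <->
  exists2 d, d \in chain X p.+1 & val y - val z = bd d.
Proof.
rewrite /hclass; split=> [/eqP|[d hd e]].
  by rewrite -Quotient.idealrBE => /asboolP[d hd e]; exists d => //; rewrite -e raddfB.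
by apply/eqP; rewrite -Quotient.idealrBE; apply/asboolP; exists d => //; rewrite -e raddfB.
Qed.

End ReducedHomology.

Section SimplicialMap.
Variables (T U : choiceType) (X : complex T) (Y : complex U).

Record smap := Smap {
  smap_fun :> T -> U;
  smapP : forall F, simplex X F -> simplex Y [fset smap_fun x | x in F]%fset
}.

Variable f : smap.

Definition push : freeab (seq T) -> freeab (seq U) :=
  extend (fun s => gen (map f s)).

HB.instance Definition _ := GRing.Additive.on push.

Lemma push_gen s : push (gen s) = gen (map f s).
Proof. exact: extend_gen. Qed.

Lemma bd_push c : bd (push c) = push (bd c).
Proof.
elim/freeab_ind: c => [s|c d IHc IHd|]; last by rewrite !raddf0.
  rewrite push_gen !bd_gen [push _]raddf_sum size_map; apply: eq_bigr => i _.
  by rewrite raddfMz /= push_gen /face map_cat map_take map_drop.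
by rewrite !raddfB /= IHc IHd.
Qed.

Variable p : nat.

Lemma push_chain c : c \in chain X p -> push c \in chain Y p.
Proof.
move=> /allP hc; rewrite /push /extend big_seq; apply: rpred_sum => s /hc.
case/andP=> /eqP sz hs; apply/rpredMz/chain_gen; rewrite /osimplex size_map sz eqxx /=.
have -> : [fset x in map f s]%fset = [fset f x | x in [fset x in s]]%fset.
  apply/fsetP => y; apply/idP/idP; rewrite in_fset /=.
    by case/mapP => x xs ->; apply: in_imfset; rewrite /= in_fset.
  by case/imfsetP => x; rewrite /= in_fset => xs ->; apply: map_f.
exact: smapP.
Qed.

Lemma push_is_cycle (z : cycle X p) : push (val z) \in is_cycle Y p.
Proof.
case: z => c /= /andP[hc /eqP bc]; rewrite inE push_chain //=.
by rewrite bd_push bc raddf0.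
Qed.

Definition cpush (z : cycle X p) : cycle Y p := Cycle (push_is_cycle z).

Definition hpush (x : rhomology X p) : rhomology Y p := hclass (cpush (hrepr x)).

End SimplicialMap.

Lemma hpush_hclass (T U : choiceType) (X : complex T) (Y : complex U)
  (f : smap X Y) p (z : cycle X p) : hpush f (hclass z) = hclass (cpush f z).
Proof.
apply/hclass_eq; have /hclass_eq[d hd e] : hclass (hrepr (hclass z)) = hclass z.
  exact: hreprK.
exists (push f d); last by rewrite bd_push -e raddfB.
exact: push_chain.
Qed.

Section FlagComplex.
Variables (T : choiceType) (P : pred T) (le : rel T).

Definition is_flag (F : {fset T}) : bool :=
  [&& F != fset0, all P F & all (fun x => all (fun y => le x y || le y x) F) F].

Lemma is_flagP (F : {fset T}) :
  reflect [/\ F != fset0, {in F, forall x, P x}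
            & {in F &, forall x y, le x y || le y x}] (is_flag F).
Proof.
apply: (iffP and3P) => -[F0 PF FF]; split=> //; first exact/allP.
- by move=> x y /(allP FF)/allP; apply.
- exact/allP.
- by apply/allP => x xF; apply/allP => y; apply: FF.
Qed.

Lemma is_flag_neq0 F : is_flag F -> F != fset0.
Proof. by case/and3P. Qed.

Lemma is_flag_sub F G : is_flag F -> (G `<=` F)%fset -> G != fset0 -> is_flag G.
Proof.
move=> /is_flagP[_ PF FF] /fsubsetP GF G0; apply/is_flagP; split=> //.
  by move=> x /GF/PF.
by move=> x y /GF xF /GF; apply: FF.
Qed.

Definition flag_complex : complex T := Complex is_flag_neq0 is_flag_sub.

End FlagComplex.

Section Estar.
Variables (K : fieldType) (V : vectType K).

Definition is_estar (X : {fset V}) : bool :=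
  (X != fset0) && ((0 \in X) ==> (<<X>> != fullv)%VS).

Lemma is_estar_neq0 X : is_estar X -> X != fset0.
Proof. by case/andP. Qed.

Lemma is_estar_sub X Y : is_estar X -> (Y `<=` X)%fset -> Y != fset0 -> is_estar Y.
Proof.
move=> /andP[_ /implyP hX] /fsubsetP YX Y0; rewrite /is_estar Y0 /=.
apply/implyP => /YX/hX; apply: contraNneq => YV.
by rewrite eqEsubv subvf -YV; apply/sub_span/YX.
Qed.

Definition estar : complex V := Complex is_estar_neq0 is_estar_sub.

Local Notation n := (\dim {:V}).

(* (g_1,...,g_n) + sum_(1 <= i <= n) (-1)^i (0,g_1,..,^g_i,..,g_n); indices are
   shifted by one. *)
Definition ext_symbol_chain (g : n.-tuple V) : freeab (seq V) :=
  gen (tval g) + \sum_(i < n) gen (0 :: face i g) *~ (-1) ^+ i.+1.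

Lemma ext_symbol_chainE g : ext_symbol_chain g = bd (gen (0 :: tval g)).
Proof.
rewrite bd_gen /= big_ord_recl /face /= drop0 mulr1z; congr (_ + _).
by rewrite size_tuple.
Qed.

Lemma ext_symbol_is_cycle (hn : (1 < n)%N) (g : n.-tuple V)
  (hg : forall i, tnth g i != 0) : ext_symbol_chain g \in is_cycle estar n.-1.
Proof.
rewrite inE; apply/andP; split; last by rewrite ext_symbol_chainE bd_bd.
have n0 : (0 < n)%N by exact: ltnW.
apply: rpredD.
  apply: chain_gen; rewrite /osimplex size_tuple prednK // eqxx /=.
  have g0 : 0 \notin tval g by apply/tnthP => -[i /esym/eqP]; apply/negP.
  rewrite /is_estar in_fset [_ \in _](negPf g0) andbT.
  apply/fset0Pn; exists (tnth g (Ordinal n0)); rewrite in_fset; exact: mem_tnth.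
apply: rpred_sum => i _; apply/rpredMz/chain_gen; rewrite /osimplex.
have sf : size (face i g) = n.-1.
  rewrite /face size_cat size_take size_drop size_tuple ltn_ord.
  by rewrite -?subn1; have := ltn_ord i; lia.
rewrite /= sf eqxx /=; apply/andP; split.
  by apply/fset0Pn; exists 0; rewrite in_fset inE eqxx.
apply/implyP => _; apply/eqP => e.
have: (\dim <<[fset x in 0%R :: face i g]%fset>> <= n.-1)%N.
  rewrite -sf; apply: leq_trans (dim_span (face i g)); apply/dimvS/span_subvP => v.
  by rewrite in_fset inE => /predU1P[->|]; [apply: mem0v | apply: memv_span].
by rewrite e leqNgt prednK ?leqnn.
Qed.

Definition ext_symbol (hn : (1 < n)%N) (g : n.-tuple V)
    (hg : forall i, tnth g i != 0) : rhomology estar n.-1 :=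
  hclass (Cycle (ext_symbol_is_cycle hn hg)).

End Estar.

Definition tits (K : fieldType) (V : vectType K) : complex {vspace V} :=
  flag_complex (fun U : {vspace V} => (U != 0%VS) && (U != fullv)) (@subsetv K V).

(* The case distinction between dim V = 2 and dim V > 2 is absorbed in the use
   of reduced homology, which differs from homology in degree 0 only. *)
Definition steinberg (K : fieldType) (V : vectType K) : zmodType :=
  rhomology (tits V) (\dim {:V}).-2.

Section FundamentalClass.
Variable n : nat.

(* The boundary of the barycentric subdivision of the (n-1)-simplex. *)
Definition bd_sd_simplex : complex {set 'I_n} :=
  flag_complex (fun A : {set 'I_n} => (A != set0) && (A != [set: 'I_n]))
               (fun A B => A \subset B).

(* {s 0} < {s 0, s 1} < ... < {s 0, ..., s (n - 2)} *)
Definition perm_flag (s : 'S_n) : seq {set 'I_n} :=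
  [seq [set s i | i : 'I_n & (i < k)%N] | k <- iota 1 n.-1].

(* The sum of all top-dimensional simplices, coherently oriented; the opposite
   orientation would change every modular symbol of V by the same sign. *)
Definition fund_chain : freeab (seq {set 'I_n}) :=
  \sum_(s : 'S_n) gen (perm_flag s) *~ (-1) ^+ s.

Lemma perm_flag_tperm (a b : 'I_n) (s : 'S_n) : b = a.+1 :> nat ->
  face a (perm_flag (tperm a b * s)%g) = face a (perm_flag s).
Proof.
move=> ba; rewrite /face /perm_flag -!map_take -!map_drop -!map_cat.
apply/eq_in_map => k; rewrite mem_cat => hk.
have {hk} ka : k != a.+1.
  apply: contraTneq hk => ->; rewrite negb_or; apply/andP; split.
    rewrite take_iota mem_iota; lia.
  rewrite drop_iota mem_iota; lia.
have tk i : ((tperm a b i < k) = (i < k))%N by case: tpermP => [->|->|//]; lia.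
apply/setP => x; apply/imsetP/imsetP => -[i]; rewrite inE => ik ->.
  by exists (tperm a b i); rewrite ?inE ?tk // permM.
by exists (tperm a b i); rewrite ?inE ?tk // permM tpermK.
Qed.

Lemma fund_chain_is_cycle : (1 < n)%N -> fund_chain \in is_cycle bd_sd_simplex n.-2.
Proof.
move=> hn; rewrite inE; apply/andP; split.
  apply: rpred_sum => s _; apply/rpredMz/chain_gen; rewrite /osimplex.
  rewrite size_map size_iota; apply/andP; split; first by apply/eqP; lia.
  apply/is_flagP; split.
  - apply/fset0Pn; eexists; rewrite in_fset; apply/map_f.
    by rewrite mem_iota; apply/andP; split; [exact: leqnn | lia].
  - move=> A; rewrite in_fset => /mapP[k]; rewrite mem_iota => hk ->.
    have n0 : (0 < n)%N by lia.
    have nn : (n.-1 < n)%N by lia.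
    apply/andP; split.
      by apply/set0Pn; exists (s (Ordinal n0)); apply/imset_f; rewrite inE /=; lia.
    apply/negP => /eqP/setP/(_ (s (Ordinal nn))); rewrite inE => /imsetP[i].
    by rewrite inE => ik /perm_inj ii; move: ik; rewrite -ii /=; lia.
  - move=> A B; rewrite !in_fset => /mapP[k _ ->] /mapP[l _ ->].
    by case/orP: (leq_total k l) => kl; apply/orP; [left|right];
      apply/imsetS/subsetP => i; rewrite !inE => /leq_trans; apply.
apply/eqP; rewrite raddf_sum /=.
have E (s : 'S_n) : bd (gen (perm_flag s) *~ (-1) ^+ s) =
    \sum_(i < n.-1) gen (face i (perm_flag s)) *~ (-1) ^+ i *~ (-1) ^+ s.
  rewrite raddfMz /= bd_gen size_map size_iota.
  exact: (big_morph (fun c => c *~ _) (mulrzDl _) (mul0rz _ _)).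
rewrite (eq_bigr _ (fun s _ => E s)) exchange_big big1 //= => i _.
have ia : (i < n)%N by have := ltn_ord i; lia.
have ib : (i.+1 < n)%N by have := ltn_ord i; lia.
pose t := tperm (Ordinal ia) (Ordinal ib).
have ot : odd_perm t by rewrite odd_tperm; apply/eqP => /(congr1 val)/=; lia.
rewrite (bigID (@odd_perm _)) /= addrC (reindex_inj (mulgI t)) /=.
apply/eqP; rewrite addr_eq0 -sumrN; apply/eqP/eq_big => [s|s _].
  by rewrite odd_permM ot /= negbK.
by rewrite (@perm_flag_tperm (Ordinal ia)) // odd_permM ot signrN mulrNz.
Qed.

Definition fund_class (hn : (1 < n)%N) : rhomology bd_sd_simplex n.-2 :=
  hclass (Cycle (fund_chain_is_cycle hn)).

End FundamentalClass.

Section ModularSymbol.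
Variables (K : fieldType) (V : vectType K).
Local Notation n := (\dim {:V}).
Variable g : n.-tuple V.

Definition span_of (v : {set 'I_n}) : {vspace V} := <<[seq tnth g i | i in v]>>%VS.

Hypothesis hg : forall i, tnth g i != 0.

Lemma span_of_simplicial (F : {fset {set 'I_n}}) :
  simplex (bd_sd_simplex n) F -> simplex (tits V) [fset span_of v | v in F]%fset.
Proof.
case/is_flagP => /fset0Pn[v0 v0F] PF FF; apply/is_flagP; split.
- by apply/fset0Pn; exists (span_of v0); apply: in_imfset.
- move=> U /imfsetP[v /= /PF/andP[/set0Pn[i iv] vT] ->]; apply/andP; split.
    apply: contra_neq (hg i) => e; apply/eqP; rewrite -memv0 -e.
    by apply/memv_span/image_f.
  apply: contraNneq vT => e; rewrite eqEcard subsetT cardsT card_ord -{1}e.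
  by apply: leq_trans (dim_span _) _; rewrite size_image.
- move=> U W /imfsetP[v /= vF ->] /imfsetP[w /= wF ->].
  have sub (v1 v2 : {set _}) : v1 \subset v2 -> (span_of v1 <= span_of v2)%VS.
    move=> /subsetP h; apply: sub_span => x /imageP[i iv ->].
    exact/image_f/h.
  by case/orP: (FF _ _ vF wF) => /sub->; rewrite ?orbT.
Qed.

Definition modular_map : smap (bd_sd_simplex n) (tits V) := Smap span_of_simplicial.

End ModularSymbol.

Definition modular_symbol (K : fieldType) (V : vectType K)
    (hn : (1 < \dim {:V})%N) (g : (\dim {:V}).-tuple V)
    (hg : forall i, tnth g i != 0) : steinberg V :=
  hpush (modular_map hg) (fund_class hn).

(* Main.v *)
From HB Require Import structures.
From mathcomp Require Import all_boot all_algebra all_fingroup.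
From mathcomp Require Import finmap boolp zify.
Require Import Defs.

Set Implicit Arguments.
Unset Strict Implicit.
Unset Printing Implicit Defensive.

Import GRing.Theory.
Local Open Scope ring_scope.

(* Let N be the complex of finite sets of non-zero vectors that do not span V.
   E^*(V) is the union of the full simplex on V \ {0} and of the cone over N with
   apex 0, hence the suspension of N: a cycle z of E^*(V) goes to the boundary of
   the part of z that avoids 0, and a cycle c of N to the difference of its cones
   with apices x and 0, for a fixed x <> 0.  Choosing a non-zero vector in each
   subspace gives a simplicial map from T(V) to N; a homotopy inverse sends a
   simplex to the flags spanned by its barycentric subdivision.  Both homotopies
   are cone constructions: a simplex s of N is carried by the full simplex on
   <s> \ {0}, and a flag by the flags below its largest member.  The symbol
   d(0,g_1,..,g_n) goes to the subdivision of d(g_1,..,g_n), which is the modular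
   symbol up to the sign (-1)^(n-1).  Finally a cycle z of E^*(V) is the boundary
   of its cone with apex 0, so the extended symbols generate. *)

(** * Chains supported on a predicate *)

Section Within.
Variable K : choiceType.
Implicit Types (P Q : pred K) (c d : freeab K).

(** [chain X p] is convertible to [within (osimplex X p)], so the lemmas on [within] apply to chains
    as they stand. *)
Definition within P : {pred freeab K} := [pred c | all P (supp c)].

Lemma withinP P c : reflect (forall k, coef k c != 0 -> P k) (c \in within P).
Proof.
by apply: (iffP allP) => h k; [rewrite -mem_supp|rewrite mem_supp]; apply: h.
Qed.

Lemma within_zmod_closed P : zmod_closed (within P).
Proof.
split=> [|c d /withinP hc /withinP hd]; apply/withinP => k.
  by rewrite raddf0 eqxx.
rewrite raddfB /=; have [c0|/hc//] := eqVneq (coef k c) 0.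
by rewrite c0 sub0r oppr_eq0; apply: hd.
Qed.

HB.instance Definition _ P :=
  GRing.isZmodClosed.Build _ (within P) (within_zmod_closed P).

Lemma within_gen P k : P k -> gen k \in within P.
Proof.
move=> Pk; apply/withinP => l; rewrite coef_gen.
by have [<-|_] := eqVneq k l; rewrite ?eqxx.
Qed.

Lemma sub_within P Q c : subpred P Q -> c \in within P -> c \in within Q.
Proof. by move=> PQ /withinP hP; apply/withinP => k /hP/PQ. Qed.

Lemma within0 c : c \in within xpred0 -> c = 0.
Proof.
move=> /withinP hc; apply: freeabP => k; rewrite raddf0.
by apply: contraTeq isT => /hc.
Qed.

Lemma within_ind P (R : freeab K -> Prop) :
  (forall k, P k -> R (gen k)) -> (forall c d, R c -> R d -> R (c - d)) ->
  R 0 -> forall c, c \in within P -> R c.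
Proof.
move=> Rg RB R0 c /allP Pc; have RN d : R d -> R (- d) by rewrite -sub0r; apply: RB.
have RD d e : R d -> R e -> R (d + e) by move=> Rd /RN; rewrite -{2}[e]opprK; apply: RB.
rewrite [c]freeab_sumE big_seq; apply: big_ind => // k /Pc Pk.
have RM n : R (gen k *+ n) by elim: n => // n IH; rewrite mulrS; apply: RD; auto.
by case: (coef k c) => n; [apply: RM | apply/RN/RM].
Qed.

End Within.

Lemma additive_within (K L : choiceType) (f : {additive freeab K -> freeab L})
    (P : pred K) (R : pred L) c :
  (forall k, P k -> f (gen k) \in within R) -> c \in within P ->
  f c \in within R.
Proof.
move=> h; elim/within_ind => [//|d e hd he|]; last by rewrite raddf0 rpred0.
by rewrite raddfB rpredB.
Qed.

(** * Faces, boundaries and cones of supported chains *)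

Section Faces.
Variable T : choiceType.
Implicit Types (s t : seq T) (c : freeab (seq T)) (x : T) (P Q : pred (seq T)).

Lemma size_face i s : (i < size s)%N -> size (face i s) = (size s).-1.
Proof. by move=> lis; rewrite /face size_cat size_take size_drop lis; lia. Qed.

Lemma mem_face i s : {subset face i s <= s}.
Proof. by move=> x; rewrite mem_cat => /orP[/mem_take|/mem_drop]. Qed.

Lemma bd_within P Q c :
  (forall s i, P s -> (i < size s)%N -> Q (face i s)) ->
  c \in within P -> bd c \in within Q.
Proof.
move=> h; apply: additive_within => s Ps; rewrite /= bd_gen.
by apply: rpred_sum => i _; apply/rpredMz/within_gen/h.
Qed.

Lemma cone_within P Q x c : (forall s, P s -> Q (x :: s)) ->
  c \in within P -> cone x c \in within Q.
Proof.
by move=> h; apply: additive_within => s Ps; rewrite /= cone_gen within_gen ?h.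
Qed.

(* The sign makes the analogue of [bd_cone] hold with no sign. *)
Definition rcone x : freeab (seq T) -> freeab (seq T) :=
  extend (fun s => gen (rcons s x) *~ (-1) ^+ size s).

HB.instance Definition _ x := GRing.Additive.on (rcone x).

Lemma rcone_gen x s : rcone x (gen s) = gen (rcons s x) *~ (-1) ^+ size s.
Proof. exact: extend_gen. Qed.

Lemma bd_rcone x c : bd (rcone x c) = c - rcone x (bd c).
Proof.
elim/freeab_ind: c => [s|c d IHc IHd|]; last by rewrite !raddf0 addr0.
  rewrite rcone_gen raddfMz /= !bd_gen size_rcons big_ord_recr /= mulrzDl.
  (* Dropping the last entry gives back [s]; its sign equals that of [rcone], so the two cancel. *)
  have -> : face (size s) (rcons s x) = s.
    by rewrite /face -cats1 take_size_cat // drop_oversize ?cats0 // size_cat addn1.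
  rewrite -mulrzA -expr2 sqrr_sign mulr1z addrC; congr (gen s + _).
  rewrite [rcone x _]raddf_sum -sumrN
    (big_morph (fun c => c *~ _) (mulrzDl _) (mul0rz _ _)).
  apply: eq_bigr => i _; rewrite raddfMz /= rcone_gen size_face //.
  have -> : face i (rcons s x) = rcons (face i s) x.
    rewrite /face -cats1 takel_cat 1?ltnW // drop_cat rcons_cat.
    have [h|h|h] := ltngtP i.+1 (size s); first by rewrite cats1.
      by have := ltn_ord i; rewrite ltnNge -ltnS h.
    by rewrite h subnn drop_size.
  (* The faces of [s] are one shorter, so [rcone] gives them the opposite sign. *)
  have -> : (-1) ^+ size s = - (-1) ^+ (size s).-1 :> int.
    by rewrite -[RHS]mulN1r -exprS prednK // (leq_ltn_trans _ (ltn_ord i)).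
  by rewrite mulrNz -!mulrzA mulrC.
by rewrite !raddfB /= IHc IHd !opprD !opprK addrACA.
Qed.

Lemma rcone_within P Q x c : (forall s, P s -> Q (rcons s x)) ->
  c \in within P -> rcone x c \in within Q.
Proof.
move=> h; apply: additive_within => s Ps /=.
by rewrite rcone_gen; apply/rpredMz/within_gen/h.
Qed.

End Faces.

Lemma push_within (T U : choiceType) (X : complex T) (Y : complex U)
    (f : smap X Y) (P : pred (seq T)) (Q : pred (seq U)) c :
  (forall s, P s -> Q (map f s)) -> c \in within P -> push f c \in within Q.
Proof.
by move=> h; apply: additive_within => s Ps; rewrite /= push_gen within_gen ?h.
Qed.

(** * Recursion over faces and carried homotopies *)

Section FaceRecursion.
Variables (T : choiceType) (M : zmodType) (G : seq T -> M -> M).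

(** Faces are not structurally smaller, so the recursion runs on the length. [G] receives [s] and
    the value already found on the boundary of [s]. *)
Fixpoint face_rec_at n s : M :=
  G s (if n is m.+1 then extend (face_rec_at m) (bd (gen s)) else 0).

Definition face_rec : freeab (seq T) -> M :=
  extend (fun s => face_rec_at (size s) s).

HB.instance Definition _ := GRing.Additive.on face_rec.

Lemma face_rec_gen s : face_rec (gen s) = G s (face_rec (bd (gen s))).
Proof.
rewrite {1}/face_rec extend_gen; case E: (size s) => [|m] /=; congr (G s _).
  by case: s E => // _; rewrite bd_gen big_ord0 raddf0.
rewrite bd_gen !raddf_sum; apply: eq_bigr => i _; rewrite !raddfMz /=.
have si : size (face i s) = m by rewrite size_face // E.
by rewrite /face_rec !extend_gen si.
Qed.

End FaceRecursion.

(* Q' s is to contain the carriers Q of all the faces of s. *)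
Lemma face_rec_within (T U : choiceType)
    (G : seq T -> freeab (seq U) -> freeab (seq U))
    (D : pred (seq T)) (Q Q' : seq T -> pred (seq U)) :
  (forall s i, D s -> (i < size s)%N -> D (face i s)) ->
  (forall s i, D s -> (i < size s)%N -> subpred (Q (face i s)) (Q' s)) ->
  (forall s c, D s -> c \in within (Q' s) -> G s c \in within (Q s)) ->
  forall s, D s -> face_rec G (gen s) \in within (Q s).
Proof.
move=> hD hQ hG s; have [m] := ubnP (size s).
elim: m s => // m IH s sm Ds; rewrite face_rec_gen; apply: hG => //.
rewrite bd_gen raddf_sum; apply: rpred_sum => i _; rewrite raddfMz; apply: rpredMz.
apply: (sub_within (hQ _ _ Ds (ltn_ord i))); apply: IH; last exact: hD.
by rewrite size_face //; have := ltn_ord i; lia.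
Qed.

Section Homotopy.
Variables (T U : choiceType) (f : {additive freeab (seq T) -> freeab (seq U)}).
Variable apex : seq T -> U.
Hypothesis f_bd : forall c, bd (f c) = f (bd c).

(** The acyclic carrier construction: the value on [s] cones off [f s] minus the value on the
    boundary of [s]. For [f = id - g] this is a chain homotopy between [g] and the identity. *)
Definition homotopy := face_rec (fun s c => cone (apex s) (f (gen s) - c)).

HB.instance Definition _ := GRing.Additive.on homotopy.

Lemma bd_homotopy c : bd (homotopy c) = f c - homotopy (bd c).
Proof.
elim/freeab_ind: c => [s|c d IHc IHd|]; last by rewrite !raddf0 addr0.
  have [m] := ubnP (size s); elim: m s => // m IH s sm.
  rewrite {1}/homotopy face_rec_gen bd_cone -/homotopy.
  (* The chain being coned off is a cycle, because the formula already holds on the faces of [s],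
     which are shorter. *)
  suff -> : bd (f (gen s) - homotopy (bd (gen s))) = 0 by rewrite raddf0 subr0.
  suff E : bd (homotopy (bd (gen s))) = f (bd (gen s)).
    by rewrite raddfB /= f_bd E subrr.
  suff : bd (homotopy (bd (gen s))) = f (bd (gen s)) - homotopy (bd (bd (gen s))).
    by rewrite bd_bd raddf0 subr0.
  rewrite bd_gen; elim/big_ind: _ => [|c d IHc IHd|i _].
  - by rewrite !raddf0 addr0.
  - by rewrite !raddfD /= IHc IHd addrACA.
  - rewrite !raddfMz /= IH ?mulrzBl ?raddfMz //.
    by rewrite size_face //; have := ltn_ord i; lia.
by rewrite !raddfB /= IHc IHd !opprD !opprK addrACA.
Qed.

(** The carrier [Q s] only has to be closed under adding the apex for non-empty [s]: since [f] kills
    the empty sequence, the generator of degree -1, the homotopy vanishes there. *)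
Lemma homotopy_within (D : pred (seq T)) (Q : seq T -> pred (seq U)) :
  f (gen [::]) = 0 ->
  (forall s i, D s -> (i < size s)%N -> D (face i s)) ->
  (forall s, D s -> s != [::] ->
     f (gen s) \in within (predI (Q s) [pred t | size t == size s])) ->
  (forall s i, D s -> (i < size s)%N -> subpred (Q (face i s)) (Q s)) ->
  (forall s t, D s -> s != [::] -> Q s t -> Q s (apex s :: t)) ->
  forall s, D s ->
    homotopy (gen s) \in within (predI (Q s) [pred t | size t == (size s).+1]).
Proof.
move=> f0 hD hf hQ hx s Ds; case: (eqVneq s [::]) Ds => [-> _|s0 Ds].
  by rewrite /homotopy face_rec_gen f0 bd_gen big_ord0 !raddf0 addr0 raddf0 rpred0.
(* [S 0] bounds what comes from the faces of [s], and [S 1] the result after coning. Both are empty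
   at [[::]], which encodes vanishing there. *)
pose S m s := if s == [::] then pred0 else
  predI (Q s) [pred t | size t == (m + size s)%N].
suff: homotopy (gen s) \in within (S 1%N s) by rewrite /S (negPf s0).
apply: (@face_rec_within _ _ _ D (S 1%N) (S 0%N)) => // {s0 Ds}s.
  move=> i Ds si t; rewrite /S; case: eqP => // _ /andP[/= /(hQ _ _ Ds si) Qt /eqP te].
  have sz := size_face si; case: eqVneq si => [->//|_] si /=.
  by rewrite Qt te sz; apply/eqP; lia.
move=> c Ds; rewrite /S; case: (eqVneq s [::]) => [->|s0] hc; last first.
  apply: (cone_within (P := S 0%N s)); last first.
    by rewrite /S (negPf s0) rpredB // hf.
  by move=> t; rewrite /S (negPf s0) => /andP[/= Qt /eqP->]; rewrite hx /=.
suff -> : c = 0 by rewrite f0 subr0 raddf0 rpred0.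
exact: within0.
Qed.

End Homotopy.

(** The value on a class is read off a representative, and sending boundaries to boundaries makes it
    independent of the choice. [F] need not commute with [bd], and the degrees are unrelated, since
    suspension shifts them. *)
Lemma induced_map (T U : choiceType) (X : complex T) (Y : complex U) (p q : nat)
    (F : freeab (seq T) -> freeab (seq U)) :
  {morph F : c d / c - d} ->
  (forall d, d \in chain X p.+1 ->
     exists2 d', d' \in chain Y q.+1 & F (bd d) = bd d') ->
  forall Fcycle : (forall z, z \in is_cycle X p -> F z \in is_cycle Y q),
  exists Phi : {additive rhomology X p -> rhomology Y q},
    forall z : cycle X p, Phi (hclass z) = hclass (Cycle (Fcycle _ (cycle_valP z))).
Proof.
move=> FB Fbd Fc; pose Fz (z : cycle X p) := Cycle (Fc _ (cycle_valP z)).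
pose Phi (x : rhomology X p) : rhomology Y q := hclass (Fz (hrepr x)).
have PhiE z : Phi (hclass z) = hclass (Fz z).
  apply/hclass_eq; have /hclass_eq[d hd e] := hreprK (hclass z).
  by have [d' hd' e'] := Fbd d hd; exists d'; rewrite // -e' -e FB.
have PhiB : additive Phi.
  move=> x y; rewrite -[x]hreprK -[y]hreprK -hclassB !PhiE -hclassB.
  by congr hclass; apply: val_inj; rewrite /= FB.
pose PhiA := GRing.isAdditive.Build _ _ Phi PhiB.
by exists (HB.pack_for {additive rhomology X p -> rhomology Y q} Phi PhiA).
Qed.

(** * Non-spanning sets and the Tits building *)

Section Complexes.
Variables (K : fieldType) (V : vectType K).
Implicit Types (s t : seq V) (u : seq {vspace V}) (U W : {vspace V}).

Lemma span_fset s : (<<[fset x in s]%fset>> = <<s>>)%VS.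
Proof. by apply: eq_span => x; rewrite in_fset. Qed.

Lemma fset_neq0 (T : choiceType) (s : seq T) :
  ([fset x in s]%fset != fset0) = (s != [::]).
Proof.
case: s => [|x s]; first by apply/negbTE/negPn/eqP/fsetP => x; rewrite in_fset.
by apply/fset0Pn; exists x; rewrite in_fset inE eqxx.
Qed.

Lemma osimplex_estar p s :
  osimplex (estar V) p s = (size s == p.+1) && ((0 \in s) ==> (<<s>> != fullv)%VS).
Proof.
rewrite /osimplex /= /is_estar fset_neq0 span_fset in_fset.
by case: s => [|x s] //=; rewrite ?andbF.
Qed.

(** The non-empty sets of this kind form the link of the vertex 0 in E^*(V). *)
Definition is_nonspanning (X : {fset V}) : bool :=
  [&& X != fset0, 0 \notin X & (<<X>> != fullv)%VS].

Lemma is_nonspanning_neq0 X : is_nonspanning X -> X != fset0.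
Proof. by case/and3P. Qed.

Lemma is_nonspanning_sub X Y :
  is_nonspanning X -> (Y `<=` X)%fset -> Y != fset0 -> is_nonspanning Y.
Proof.
move=> /and3P[_ X0 hX] /fsubsetP YX Y0; rewrite /is_nonspanning Y0 /=.
rewrite (contra (YX 0)) //=; apply: contraNneq hX => YV.
by rewrite eqEsubv subvf -YV; apply/sub_span/YX.
Qed.

Definition nonspanning : complex V := Complex is_nonspanning_neq0 is_nonspanning_sub.

Lemma osimplex_nonspanning p s : osimplex nonspanning p s =
  [&& size s == p.+1, 0 \notin s & (<<s>> != fullv)%VS].
Proof.
rewrite /osimplex /= /is_nonspanning fset_neq0 span_fset in_fset.
by case: s => [|x s] //=; rewrite ?andbF.
Qed.

Definition proper_vspace U := (U != 0%VS) && (U != fullv).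

Definition nested U W := ((U <= W) || (W <= U))%VS.

Lemma osimplex_tits p u : osimplex (tits V) p u =
  [&& size u == p.+1, all proper_vspace u & all2rel nested u].
Proof.
rewrite /osimplex /=; case su : (size u == p.+1) => //=.
have u0 : u != [::] by case: u su.
apply/is_flagP/andP => [[_ P C]|[/allP P /allrelP C]]; split.
- by apply/allP => U Uu; apply: P; rewrite in_fset.
- by apply/allrelP => U W Uu Wu; apply: C; rewrite in_fset.
- by rewrite fset_neq0.
- by move=> U; rewrite in_fset => /P.
- by move=> U W; rewrite !in_fset; apply: C.
Qed.

Lemma nested_top u : u != [::] -> all2rel nested u ->
  exists2 U, U \in u & {in u, forall W, (W <= U)%VS}.
Proof.
elim: u => // U u IH _ /allrelP C.
have [->|u0] := eqVneq u [::].
  by exists U => [|W]; rewrite inE // => /eqP->.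
have [|W Wu hW] := IH u0.
  by apply/allrelP => x y xu yu; apply: C; rewrite inE ?xu ?yu orbT.
have /orP[UW|WU] : nested U W by apply: C; rewrite inE ?eqxx ?Wu ?orbT.
  by exists W => [|x]; rewrite inE ?Wu ?orbT // => /predU1P[->|/hW].
exists U; first exact: mem_head.
by move=> x /predU1P[->|/hW xW]; rewrite ?subvv // (subv_trans xW).
Qed.

(** The sum of a flag is its largest member. This expresses the apex of the homotopy on T(V) by a
    formula. *)
Lemma mem_sumv u : u != [::] -> all2rel nested u -> (\sum_(U <- u) U)%VS \in u.
Proof.
move=> u0 /(nested_top u0)[U Uu hU]; suff -> : (\sum_(W <- u) W)%VS = U by [].
apply/eqP; rewrite eqEsubv; apply/andP; split.
  by rewrite big_seq; elim/big_ind: _ => [|X Y|//]; rewrite ?sub0v // subv_add => -> ->.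
by rewrite (big_rem _ Uu) addvSl.
Qed.

Lemma sumv_seq_sup u U : U \in u -> (U <= \sum_(W <- u) W)%VS.
Proof. by move=> Uu; rewrite (big_rem _ Uu) addvSl. Qed.

(** The chosen vectors all lie in the largest member of the flag, which is a proper subspace. *)
Lemma vpick_simplicial (F : {fset {vspace V}}) :
  simplex (tits V) F -> simplex nonspanning [fset vpick U | U in F]%fset.
Proof.
case/is_flagP=> F0 P C.
have [||U UF hU] := @nested_top (enum_fset F).
- case/fset0Pn: F0 => U; apply: contraTneq => F0.
  by rewrite -[_ \in _]/(U \in enum_fset F) F0.
- exact/allrelP.
apply/and3P; split.
- by apply/fset0Pn; exists (vpick U); apply: in_imfset.
- by apply/imfsetP => -[W /P/andP[W0 _]] /esym/eqP; rewrite vpick0 (negPf W0).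
- have /andP[_] := P U UF; apply: contraNneq => FV; rewrite eqEsubv subvf -FV.
  apply/span_subvP => x /imfsetP[W WF ->].
  by apply: subvP (hU W WF) _ (memv_pick W).
Qed.

Definition vpick_map : smap (tits V) nonspanning := Smap vpick_simplicial.

(* (v_0, .., v_p) goes to the alternating sum of the flags
   <v_s0> <= <v_s0, v_s1> <= .. <= <v_s0, .., v_sp> over the permutations s. *)
Definition subdiv : freeab (seq V) -> freeab (seq {vspace V}) :=
  face_rec (fun s c => if nilp s then gen [::] else rcone <<s>>%VS c).

HB.instance Definition _ := GRing.Additive.on subdiv.

Lemma subdiv_nil : subdiv (gen [::]) = gen [::].
Proof. by rewrite /subdiv face_rec_gen. Qed.

Lemma subdiv_gen s : s != [::] ->
  subdiv (gen s) = rcone <<s>>%VS (subdiv (bd (gen s))).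
Proof. by rewrite {1}/subdiv face_rec_gen; case: s. Qed.

(** By [bd_rcone] the two sides differ by a cone over [bd (subdiv (bd s))], which by induction on
    the length is [subdiv (bd (bd s)) = 0]. *)
Lemma bd_subdiv c : bd (subdiv c) = subdiv (bd c).
Proof.
elim/freeab_ind: c => [s|c d IHc IHd|]; last by rewrite !raddf0.
  have [m] := ubnP (size s); elim: m s => // m IH s sm.
  have [->|s0] := eqVneq s [::]; first by rewrite subdiv_nil !bd_gen !big_ord0 raddf0.
  rewrite subdiv_gen // bd_rcone.
  suff -> : bd (subdiv (bd (gen s))) = subdiv (bd (bd (gen s))).
    by rewrite bd_bd !raddf0 addr0.
  rewrite bd_gen; elim/big_ind: _ => [|c d IHc IHd|i _].
  - by rewrite !raddf0.
  - by rewrite !raddfD /= IHc IHd.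
  - rewrite !raddfMz /= IH //.
    by rewrite size_face //; have := ltn_ord i; lia.
by rewrite !raddfB /= IHc IHd.
Qed.

Definition span_flag s : pred (seq {vspace V}) :=
  [pred u | all (fun U => (U != 0%VS) && (U <= <<s>>)%VS) u && all2rel nested u].

Lemma subdiv_within s : 0 \notin s ->
  subdiv (gen s) \in within [pred u | (size u == size s) && span_flag s u].
Proof.
pose Q' s := [pred u | (size u == (size s).-1) && span_flag s u].
pose Q s := [pred u | (size u == size s) && span_flag s u].
apply: (@face_rec_within _ _ _ (fun s => 0 \notin s) Q Q') => {}s.
- by move=> i s0 _; apply: contra s0 => /mem_face.
- move=> i s0 si u /and3P[/eqP su /allP hu cu].
  apply/and3P; split=> //; first by rewrite su size_face.
  apply/allP => U /hu/andP[->] /subv_trans; apply; apply: sub_span; exact: mem_face.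
- move=> c s0 hc; case: nilP => [->|sn]; first by rewrite within_gen.
  apply: rcone_within hc => u /and3P[/eqP su /allP hu /allrelP cu] /=.
  have s1 : (0 < size s)%N by case: (s) sn.
  apply/and3P; split; first by rewrite size_rcons su prednK.
    rewrite all_rcons subvv andbT; apply/andP; split; last exact/allP.
    (* A non-zero entry of [s] keeps the new last member [<<s>>] non-zero. *)
    case: s s0 sn {su s1 hu} => // x s + _; rewrite inE negb_or eq_sym => /andP[x0 _].
    by apply: contraNneq x0 => e; rewrite -memv0 -e; apply/memv_span/mem_head.
  apply/allrelP => U W; rewrite !mem_rcons !inE /nested.
  move=> /predU1P[->|Uu] /predU1P[->|Wu]; last exact: cu.
  + by rewrite subvv.
  + by have /andP[_ ->] := hu W Wu; rewrite orbT.
  + by have /andP[_ ->] := hu U Uu.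
Qed.

(** * Both composites are homologous to the identity *)

Lemma push_subdiv_within s : 0 \notin s ->
  push vpick_map (subdiv (gen s)) \in
    within [pred t | all (fun v => (v != 0) && (v \in <<s>>%VS)) t && (size t == size s)].
Proof.
move=> /subdiv_within; apply: push_within => u /and3P[/= su /allP hu _].
rewrite size_map su andbT; apply/allP => _ /mapP[U /hu/andP[U0 US] ->].
by rewrite vpick0 U0 (subvP US) ?memv_pick.
Qed.

(** The carrier of [s] consists of all sequences of non-zero vectors of [<<s>>]; they span no more
    than [s] does, and any vector of [s] may serve as apex. *)
Lemma push_subdiv_homologous p c : c \in is_cycle nonspanning p ->
  exists2 d, d \in chain nonspanning p.+1 & c - push vpick_map (subdiv c) = bd d.
Proof.
case/andP=> hc /eqP bc.
pose f : {additive freeab (seq V) -> freeab (seq V)} :=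
  idfun \- (push vpick_map \o subdiv).
have f_bd d : bd (f d) = f (bd d) by rewrite raddfB /= bd_push bd_subdiv.
(* The default 0 is the apex only at the empty sequence, where [f] vanishes. *)
pose H := homotopy f (head 0).
pose Q s := [pred t | all (fun v => (v != 0) && (v \in <<s>>%VS)) t].
have Hw s : 0 \notin s ->
    H (gen s) \in within (predI (Q s) [pred t | size t == (size s).+1]).
  apply: (@homotopy_within _ _ f (head 0) (fun s => 0 \notin s) Q).
  - by rewrite /= subdiv_nil push_gen subrr.
  - by move=> {}s i s0 _; apply: contra s0 => /mem_face.
  - move=> {}s s0 _; rewrite rpredB ?push_subdiv_within // within_gen //= eqxx andbT.
    by apply/allP => v vs; rewrite (memv_span vs) andbT; apply: contraNneq s0 => <-.
  - move=> {}s i s0 si t /allP ht; apply/allP => v /ht/andP[-> vs] /=.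
    by apply: subvP vs; apply: sub_span; apply: mem_face.
  - case=> // x s' t + _ /= ->; rewrite inE negb_or eq_sym => /andP[-> _].
    by rewrite memv_span ?mem_head.
exists (H c); last by rewrite bd_homotopy // bc raddf0 subr0.
apply: additive_within hc => s; rewrite osimplex_nonspanning => /and3P[/eqP sz s0 sV].
apply: sub_within (Hw s s0) => t /andP[/= /allP ht /eqP st].
rewrite osimplex_nonspanning st sz eqxx /=; apply/andP; split.
  by apply/negP => /ht; rewrite eqxx.
apply: contraNneq sV => tV; rewrite eqEsubv subvf -tV.
by apply/span_subvP => v /ht/andP[].
Qed.

(** The carrier of [u] consists of the flags of non-zero subspaces of the largest member of [u].
    That member is comparable with all of them, hence an apex. *)
Lemma subdiv_push_homologous p c : c \in is_cycle (tits V) p ->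
  exists2 d, d \in chain (tits V) p.+1 & c - subdiv (push vpick_map c) = bd d.
Proof.
case/andP=> hc /eqP bc.
pose f : {additive freeab (seq {vspace V}) -> freeab (seq {vspace V})} :=
  idfun \- (subdiv \o push vpick_map).
have f_bd d : bd (f d) = f (bd d) by rewrite raddfB /= bd_subdiv bd_push.
pose D u := all proper_vspace u && all2rel nested u.
pose Q u := [pred u' | all (fun U => (U != 0%VS) && (U <= \sum_(W <- u) W)%VS) u'
                       && all2rel nested u'].
pose H := homotopy f (fun u => \sum_(W <- u) W)%VS.
have Hw u : D u ->
    H (gen u) \in within (predI (Q u) [pred t | size t == (size u).+1]).
  apply: (@homotopy_within _ _ f _ D Q).
  - by rewrite /= push_gen subdiv_nil subrr.
  - move=> {}u i /andP[/allP hu /allrelP cu] _; apply/andP; split.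
      by apply/allP => U /mem_face/hu.
    by apply/allrelP => U W /mem_face Uu /mem_face; apply: cu.
  - move=> {}u /andP[/allP hu cu] _; rewrite rpredB //.
      rewrite within_gen //= eqxx cu !andbT; apply/allP => U Uu.
      by have /andP[-> _] := hu _ Uu; rewrite sumv_seq_sup.
    rewrite /= push_gen; set s := map _ u.
    have s0 : 0 \notin s.
      by apply/mapP => -[U /hu/andP[U0 _]] /esym/eqP; rewrite vpick0 (negPf U0).
    apply: sub_within (subdiv_within s0) => u' /and3P[/= su' /allP hu' ->].
    rewrite size_map in su'; rewrite su' !andbT.
    apply/allP => U /hu'/andP[-> /= /subv_trans]; apply.
    apply/span_subvP => _ /mapP[W Wu ->].
    exact: subvP (sumv_seq_sup Wu) _ (memv_pick W).
  - move=> {}u i /andP[_ _] si u' /andP[/allP hu' cu']; rewrite /= cu' andbT.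
    apply/allP => U /hu'/andP[-> /= /subv_trans]; apply.
    rewrite big_seq; elim/big_ind: _ => [|X Y|W /mem_face]; rewrite ?sub0v //.
      by rewrite subv_add => -> ->.
    exact: sumv_seq_sup.
  - move=> {}u u' /andP[/allP hu cu] u0 /andP[hu' /allrelP cu'].
    have /andP[a0 _] := hu _ (mem_sumv u0 cu).
    rewrite /= a0 hu' subvv /=; apply/allrelP => U W; rewrite !inE /nested.
    move/allP in hu'.
    move=> /predU1P[->|Uu] /predU1P[->|Wu]; last exact: cu'.
    + by rewrite subvv.
    + by have /andP[_ ->] := hu' W Wu; rewrite orbT.
    + by have /andP[_ ->] := hu' U Uu.
exists (H c); last by rewrite bd_homotopy // bc raddf0 subr0.
apply: additive_within hc => u; rewrite osimplex_tits => /and3P[/eqP sz pu cu].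
have Du : D u by rewrite /D pu.
apply: sub_within (Hw u Du) => t /andP[/= /andP[/allP ht ct] /eqP st].
rewrite osimplex_tits st sz eqxx ct andbT /=; apply/allP => U /ht/andP[U0 US].
rewrite /proper_vspace U0; have /allP/(_ _ (mem_sumv _ cu))/andP[] := pu.
  by case: (u) sz.
by move=> _; apply: contraNneq => UV; rewrite eqEsubv subvf -UV.
Qed.
End Complexes.

(** * The subdivision as a sum over permutations *)

(** Permutations are sorted by their value at [i]. For [i = ord_max] this matches them with pairs of
    a face and a permutation of its entries. *)
Lemma lift_perm_bij m (i : 'I_m.+1) :
  bijective (fun p : 'I_m.+1 * 'S_m => lift_perm i p.1 p.2).
Proof.
apply: inj_card_bij => [[j s] [k t] /= e|]; last first.
  by rewrite card_prod card_ord !card_Sn factS.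
have jk : j = k by rewrite -(lift_perm_id i j s) e lift_perm_id.
rewrite -{}jk in e *; congr (_, _); apply/permP => x; apply: (@lift_inj _ j).
by rewrite -!(lift_perm_lift i) e.
Qed.

Lemma nth_face (T : Type) (x0 : T) i (s : seq T) j :
  (i < size s)%N -> nth x0 (take i s ++ drop i.+1 s) j = nth x0 s (bump i j).
Proof.
move=> si; rewrite nth_cat size_take si /bump; case: ltnP => ij.
  by rewrite nth_take.
by rewrite nth_drop add1n addSn subnKC.
Qed.

Section PermutationFlags.
Variables (K : fieldType) (V : vectType K).
Implicit Types s : seq V.

Definition perm_span m s (sigma : 'S_m) (k : nat) : {vspace V} :=
  (\sum_(j < m | (j < k)%N) <[nth 0%R s (sigma j)]>)%VS.

(** [lift_perm ord_max i sigma] puts the vector of index [i] last, so the first [m] vectors are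
    those of the face omitting it. *)
Lemma perm_span_lift m s (i : 'I_m.+1) (sigma : 'S_m) k :
  size s = m.+1 -> (k <= m)%N ->
  perm_span s (lift_perm ord_max i sigma) k = perm_span (face i s) sigma k.
Proof.
move=> sm km; rewrite /perm_span big_mkcond big_ord_recr /= ltnNge km addv0.
rewrite [RHS]big_mkcond; apply: eq_bigr => j _; case: ifP => // _.
have -> : widen_ord (leqnSn m) j = lift ord_max j.
  by apply: val_inj; rewrite -[RHS]/(nat_of_ord _) lift_max.
by rewrite lift_perm_lift /face nth_face // sm.
Qed.

Lemma perm_span_full m s (sigma : 'S_m) : size s = m ->
  perm_span s sigma m = <<s>>%VS.
Proof.
move=> sm; rewrite span_def (big_nth 0) sm big_mkord (reindex_perm sigma).
by apply: eq_bigl => j; rewrite ltn_ord.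
Qed.

(** The length [k] is separate from [m]: for [k = m] the flags end in [<<s>>] when [s] has [m]
    entries, while [k = m.-1] drops this member and gives the flags of the modular symbol. *)
Definition perm_flags m k s : freeab (seq {vspace V}) :=
  \sum_(sigma : 'S_m) gen [seq perm_span s sigma j | j <- iota 1 k] *~ (-1) ^+ sigma.

(** Faces and their permutations together run through all of ['S_m.+1]. The parity of the lifted
    permutation is that of [m + i] plus that of [sigma], whence the factor [(-1) ^+ m]. The formula
    for the faces is a hypothesis so that the step can serve inside the next induction. *)
Lemma subdiv_bd_step m s : size s = m.+1 ->
  (forall t, size t = m -> subdiv (gen t) = perm_flags m m t) ->
  subdiv (bd (gen s)) = perm_flags m.+1 m s *~ (-1) ^+ m.
Proof.
move=> sm IH; rewrite bd_gen -(big_mkord xpredT (fun i => gen (face i s) *~ (-1) ^+ i)).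
rewrite sm big_mkord raddf_sum.
rewrite [X in X *~ _](reindex _ (onW_bij _ (lift_perm_bij ord_max))) /=.
rewrite -(pair_bigA _ (fun i sigma => gen [seq perm_span s (lift_perm ord_max i sigma) j
   | j <- iota 1 m] *~ (-1) ^+ (lift_perm ord_max i sigma))) /=.
rewrite (big_morph (fun c => c *~ _) (mulrzDl _) (mul0rz _ _)).
apply: eq_bigr => i _; rewrite raddfMz /= IH; last by rewrite size_face ?sm.
rewrite /perm_flags !(big_morph (fun c => c *~ _) (mulrzDl _) (mul0rz _ _)).
apply: eq_bigr => sigma _; rewrite odd_lift_perm /=.
have -> : [seq perm_span s (lift_perm ord_max i sigma) j | j <- iota 1 m] =
          [seq perm_span (face i s) sigma j | j <- iota 1 m].
  apply/eq_in_map => j; rewrite mem_iota add1n ltnS => /andP[_ jm].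
  exact: perm_span_lift.
move: (odd_perm sigma) => b; rewrite -!mulrzA !signr_addb !signr_odd.
congr (gen _ *~ _).
by rewrite [RHS]mulrC !mulrA -expr2 sqrr_sign mul1r mulrC.
Qed.

Lemma subdiv_perm m s : size s = m -> subdiv (gen s) = perm_flags m m s.
Proof.
elim: m s => [|m IH] s sm.
  rewrite (size0nil sm) subdiv_nil /perm_flags (big_pred1 1%g) => [|sigma].
    by rewrite odd_perm1 mulr1z.
  by apply/esym/eqP/permP => -[].
rewrite subdiv_gen; last by case: (s) sm.
rewrite (subdiv_bd_step sm IH) raddfMz /= /perm_flags.
have -> : iota 1 m.+1 = rcons (iota 1 m) m.+1.
  by rewrite -[X in iota _ X]addn1 iotaD add1n cats1.
rewrite raddf_sum (big_morph (fun c => c *~ _) (mulrzDl _) (mul0rz _ _)).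
apply: eq_bigr => sigma _; rewrite raddfMz /= rcone_gen size_map size_iota.
rewrite map_rcons perm_span_full //.
(* The sign of [rcone] cancels the factor [(-1) ^+ m] of the boundary. *)
by rewrite -!mulrzA mulrC -mulrA -expr2 sqrr_sign mulr1.
Qed.

Lemma subdiv_bd_perm m s : size s = m.+1 ->
  subdiv (bd (gen s)) = perm_flags m.+1 m s *~ (-1) ^+ m.
Proof. by move=> sm; apply: subdiv_bd_step sm (@subdiv_perm m). Qed.

Lemma perm_span_of (g : (\dim {:V}).-tuple V) (sigma : 'S_(\dim {:V})) k :
  span_of g [set sigma i | i : 'I__ & (i < k)%N] = perm_span g sigma k.
Proof.
rewrite /span_of span_def big_image big_imset /=; last by move=> ? ? _ _ /perm_inj.
by apply: eq_big => i; rewrite ?inE // => _; rewrite (tnth_nth 0).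
Qed.
End PermutationFlags.

(** * E^*(V) as a suspension *)

Section NonzeroPart.
Variable V : zmodType.
Implicit Types (P : pred (seq V)) (c : freeab (seq V)).

(** Not a chain map: a face of a simplex containing 0 may avoid 0. For chains of E^*(V) this defect
    lies in N and gives the inverse of suspension. *)
Definition nonzero_part : freeab (seq V) -> freeab (seq V) :=
  extend (fun s : seq V => if 0 \in s then 0 else gen s).

HB.instance Definition _ := GRing.Additive.on nonzero_part.

Lemma nonzero_part_gen s :
  nonzero_part (gen s) = if 0 \in s then 0 else gen s.
Proof. exact: extend_gen. Qed.

Lemma nonzero_part_within P c : c \in within P ->
  nonzero_part c \in within [pred s : seq V | P s && (0 \notin s)].
Proof.
apply: additive_within => s Ps; rewrite /= nonzero_part_gen.
by case: ifP => s0; [exact: rpred0|rewrite within_gen //= Ps s0].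
Qed.

Lemma zero_part_within P c : c \in within P ->
  c - nonzero_part c \in within [pred s : seq V | P s && (0 \in s)].
Proof.
elim/within_ind => [s Ps|d e hd he|]; last by rewrite raddf0 subr0 rpred0.
  rewrite nonzero_part_gen; case: ifP => s0; last by rewrite subrr rpred0.
  by rewrite subr0 within_gen //= Ps s0.
by rewrite raddfB opprD addrACA -opprD rpredB.
Qed.

Lemma nonzero_part_id c : c \in within [pred s : seq V | 0 \notin s] ->
  nonzero_part c = c.
Proof.
move=> /zero_part_within hc; apply/esym/eqP; rewrite -subr_eq0; apply/eqP/within0.
by apply: sub_within hc => s /=; rewrite andNb.
Qed.

Lemma nonzero_part_eq0 c : c \in within [pred s : seq V | 0 \in s] -> nonzero_part c = 0.
Proof.
move=> /nonzero_part_within hc; apply: within0.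
by apply: sub_within hc => s /=; rewrite andbN.
Qed.

End NonzeroPart.

Section Suspension.
Variables (K : fieldType) (V : vectType K).
Implicit Types (s : seq V) (c d z : freeab (seq V)).

Lemma span_neq_sub s t : {subset s <= t} ->
  (<<t>> != fullv -> <<s>> != fullv :> {vspace V})%VS.
Proof. by move=> st; apply: contraNneq => sV; rewrite eqEsubv subvf -sV sub_span. Qed.

Lemma span_cons0 s : <<0%R :: s>>%VS = <<s>>%VS.
Proof. by rewrite span_cons; apply/addv_idPr; rewrite -memvE mem0v. Qed.

Lemma bd_nonspanning p c :
  c \in within [pred s : seq V | [&& size s == p.+2, 0 \in s & (<<s>> != fullv)%VS]] ->
  nonzero_part (bd c) \in chain (nonspanning V) p.
Proof.
move=> hc; have {hc} : bd c \in
    within [pred s : seq V | (size s == p.+1) && (<<s>> != fullv)%VS].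
  apply: bd_within hc => s i /and3P[/eqP sz _ sV] si /=; rewrite size_face // sz eqxx /=.
  exact: span_neq_sub (@mem_face _ i s) sV.
move=> /nonzero_part_within; apply: sub_within => s /=.
by rewrite osimplex_nonspanning => /andP[/andP[-> ->] ->].
Qed.

Lemma nonzero_part_bd c : nonzero_part (bd (nonzero_part c)) = bd (nonzero_part c).
Proof.
have : nonzero_part c \in within [pred s : seq V | predT s && (0 \notin s)].
  exact/nonzero_part_within/withinP.
move=> hc; apply: nonzero_part_id; apply: bd_within hc => s i /= s0 _.
by apply: contra s0 => /mem_face.
Qed.

Lemma zero_part_estar p c : c \in chain (estar V) p -> c - nonzero_part c \in
  within [pred s : seq V | [&& size s == p.+1, 0 \in s & (<<s>> != fullv)%VS]].
Proof.
move=> /zero_part_within; apply: sub_within => s /=.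
by rewrite osimplex_estar => /andP[/andP[-> +] s0]; rewrite s0.
Qed.

Lemma nonzero_part_estar p c : c \in chain (estar V) p ->
  nonzero_part c \in within [pred s : seq V | (size s == p.+1) && (0 \notin s)].
Proof.
move=> /nonzero_part_within; apply: sub_within => s /=.
by rewrite osimplex_estar => /andP[/andP[-> _] ->].
Qed.

(** The boundary of the part avoiding 0 is minus that of the part through 0. The first avoids 0 and
    the second has only non-spanning simplices, so both lie in N. *)
Lemma desuspension_is_cycle p z : z \in is_cycle (estar V) p.+1 ->
  bd (nonzero_part z) \in is_cycle (nonspanning V) p.
Proof.
case/andP=> hz /eqP bz; rewrite inE bd_bd eqxx andbT -nonzero_part_bd.
have -> : bd (nonzero_part z) = - bd (z - nonzero_part z).
  by rewrite raddfB /= bz sub0r opprK.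
by rewrite raddfN rpredN; apply/bd_nonspanning/zero_part_estar.
Qed.

Lemma desuspension_bd p d : d \in chain (estar V) p.+2 ->
  exists2 d', d' \in chain (nonspanning V) p.+1 & bd (nonzero_part (bd d)) = bd d'.
Proof.
(* The part of [d] avoiding 0 contributes only [bd (bd _) = 0], so the witness comes from the part
   through 0. *)
move=> hd; exists (nonzero_part (bd (d - nonzero_part d))).
  exact/bd_nonspanning/zero_part_estar.
by rewrite !raddfB /= nonzero_part_bd bd_bd subr0.
Qed.

Variable x : V.
Hypothesis x0 : x != 0.

Definition suspension c := cone x c - cone 0 c.

Lemma suspensionB : {morph suspension : c d / c - d}.
Proof. by move=> c d; rewrite /suspension !raddfB /= addrACA. Qed.

Lemma cone_estar p c : c \in within [pred s : seq V | (size s == p.+1) && (0 \notin s)] ->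
  cone x c \in chain (estar V) p.+1.
Proof.
apply: cone_within => s /andP[/eqP sz s0].
by rewrite osimplex_estar /= sz eqxx inE eq_sym (negPf x0) (negPf s0).
Qed.

Lemma cone0_estar p c :
  c \in within [pred s : seq V | (size s == p.+1) && (<<s>> != fullv)%VS] ->
  cone 0 c \in chain (estar V) p.+1.
Proof.
apply: cone_within => s /andP[/eqP sz sV].
by rewrite osimplex_estar /= sz eqxx span_cons0 sV implybT.
Qed.

Lemma nonspanning_within p c : c \in chain (nonspanning V) p ->
  c \in within [pred s : seq V | (size s == p.+1) && (0 \notin s)] /\
  c \in within [pred s : seq V | (size s == p.+1) && (<<s>> != fullv)%VS].
Proof.
by move=> hc; split; apply: sub_within hc => s /=; rewrite osimplex_nonspanning;
   case/and3P=> -> h1 h2.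
Qed.

Lemma suspension_is_cycle p c : c \in is_cycle (nonspanning V) p ->
  suspension c \in is_cycle (estar V) p.+1.
Proof.
case/andP=> /nonspanning_within[h h'] /eqP bc; rewrite inE; apply/andP; split.
  by rewrite rpredB ?cone_estar ?cone0_estar.
by rewrite raddfB /= !bd_cone bc !raddf0 subrr.
Qed.

Lemma suspension_bd p d : d \in chain (nonspanning V) p.+1 ->
  exists2 d', d' \in chain (estar V) p.+2 & suspension (bd d) = bd d'.
Proof.
(* Suspension anticommutes with [bd], hence the opposite order of the cones. *)
move=> /nonspanning_within[h h']; exists (cone 0 d - cone x d).
  by rewrite rpredB ?cone_estar ?cone0_estar.
by rewrite raddfB /= !bd_cone opprB addrC addrA subrK.
Qed.

(** This holds already for chains: only the cone with apex [x] avoids 0, and its boundary is [c]. *)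
Lemma desuspensionK p c : c \in is_cycle (nonspanning V) p ->
  bd (nonzero_part (suspension c)) = c.
Proof.
case/andP=> /nonspanning_within[h _] /eqP bc; rewrite raddfB /=.
rewrite nonzero_part_id; last first.
  by apply: cone_within h => s /andP[_ s0]; rewrite /= inE negb_or eq_sym x0.
rewrite nonzero_part_eq0; last by apply: cone_within h => s _; rewrite /= mem_head.
by rewrite subr0 bd_cone bc raddf0 subr0.
Qed.

Lemma suspensionK p z : z \in is_cycle (estar V) p.+1 ->
  exists2 d, d \in chain (estar V) p.+2 &
    z - suspension (bd (nonzero_part z)) = bd d.
Proof.
move=> hz; have /andP[cz /eqP bz] := hz.
have /andP[/nonspanning_within[hw hw'] _] := desuspension_is_cycle hz.
set a := nonzero_part z; set w := bd a; set b := z - a.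
have bb : bd b = - w by rewrite raddfB /= bz sub0r.
(* The difference splits into the cycles [a - cone x w], in the full simplex on the non-zero
   vectors, and [b + cone 0 w], in the cone over N; each is coned off there. *)
exists (cone x (a - cone x w) + cone 0 (b + cone 0 w)).
  apply: rpredD; [apply: cone_estar|apply: cone0_estar].
    rewrite rpredB ?nonzero_part_estar //.
    apply: cone_within hw => s /andP[/eqP sz s0].
    by rewrite /= sz eqxx inE negb_or eq_sym x0.
  rewrite rpredD //.
    by apply: sub_within (zero_part_estar cz) => s /and3P[/= -> _].
  apply: cone_within hw' => s /andP[/eqP sz sV].
  by rewrite /= sz eqxx span_cons0.
rewrite [RHS]raddfD /= !bd_cone.
have -> : bd (a - cone x w) = 0 by rewrite raddfB /= bd_cone bd_bd raddf0 subr0 subrr.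
have -> : bd (b + cone 0 w) = 0.
  by rewrite raddfD /= bd_cone bd_bd raddf0 subr0 bb addNr.
rewrite !raddf0 !addr0 /suspension opprB [RHS]addrACA [a + _]addrC subrK.
by rewrite [- _ + _]addrC.
Qed.

End Suspension.

(** * The isomorphism *)

Section Isomorphism.
Variables (K : fieldType) (V : vectType K).

Lemma subdiv_chain p c : c \in chain (nonspanning V) p -> subdiv c \in chain (tits V) p.
Proof.
apply: additive_within => s; rewrite osimplex_nonspanning => /and3P[/eqP sz s0 sV].
apply: sub_within (subdiv_within s0) => u /and3P[/= /eqP su /allP hu cu].
rewrite osimplex_tits su sz eqxx cu andbT /=; apply/allP => U /hu/andP[U0 Us].
by rewrite /proper_vspace U0; apply: contraNneq sV => UV; rewrite eqEsubv subvf -UV.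
Qed.

Lemma subdiv_is_cycle p c : c \in is_cycle (nonspanning V) p ->
  subdiv c \in is_cycle (tits V) p.
Proof.
by case/andP=> hc /eqP bc; rewrite inE subdiv_chain //= bd_subdiv bc raddf0.
Qed.

(* The exponent k adjusts the sign to that of the modular symbols. *)
Definition flag_part (k : nat) (z : freeab (seq V)) : freeab (seq {vspace V}) :=
  subdiv (bd (nonzero_part z)) *~ (-1) ^+ k.

(** The degrees are linked by an equation because [(\dim {:V}).-1] and [(\dim {:V}).-2.+1] are not
    convertible. *)
Lemma flag_part_is_cycle k q p (pE : q = p.+1) z : z \in is_cycle (estar V) q ->
  flag_part k z \in is_cycle (tits V) p.
Proof. by rewrite pE => hz; apply/rpredMz/subdiv_is_cycle/desuspension_is_cycle. Qed.

Lemma homology_estar_tits k q p (pE : q = p.+1) x : x != 0 :> V ->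
  exists2 Phi : {additive rhomology (estar V) q -> rhomology (tits V) p},
    bijective Phi &
    forall z : cycle (estar V) q,
      Phi (hclass z) = hclass (Cycle (flag_part_is_cycle k pE (cycle_valP z))).
Proof.
move=> x0; subst q.
pose G c := suspension x (push (vpick_map V) c) *~ (-1) ^+ k.
have push_cycle c : c \in is_cycle (tits V) p ->
    push (vpick_map V) c \in is_cycle (nonspanning V) p.
  move=> hc; exact: (push_is_cycle (vpick_map V) (Cycle hc)).
have GC c : c \in is_cycle (tits V) p -> G c \in is_cycle (estar V) p.+1.
  by move=> hc; apply/rpredMz/suspension_is_cycle/push_cycle.
have [||Phi PhiE] := @induced_map _ _ (estar V) (tits V) _ _ (flag_part k) _ _
    (@flag_part_is_cycle k _ p erefl).
- by move=> c d; rewrite /flag_part !raddfB mulrzBl.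
- move=> d /desuspension_bd[d' hd' e]; exists (subdiv d' *~ (-1) ^+ k).
    exact/rpredMz/subdiv_chain.
  by rewrite /flag_part e raddfMz /= bd_subdiv.
have [||Psi PsiE] := @induced_map _ _ (tits V) (estar V) _ _ G _ _ GC.
- by move=> c d; rewrite /G raddfB suspensionB mulrzBl.
- move=> d /(push_chain (vpick_map V))/(suspension_bd x0)[d' hd' e].
  by exists (d' *~ (-1) ^+ k); [exact: rpredMz|rewrite /G -bd_push e raddfMz].
exists Phi; last exact: PhiE.
have suspMz c m : suspension x (c *~ m) = suspension x c *~ m.
  by rewrite /suspension !(raddfMz (cone _)) mulrzBl.
exists Psi => h.
  rewrite -[h]hreprK; case: (hrepr h) => z hz; rewrite PhiE PsiE.
  apply/esym/hclass_eq => /=; rewrite /G /flag_part.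
  have hw := desuspension_is_cycle hz.
  have [d hd e] := push_subdiv_homologous hw.
  have [d1 hd1 e1] := suspension_bd x0 hd.
  have [d2 hd2 e2] := suspensionK x0 hz.
  (* With [w] the desuspension of [z], the difference is [z - suspension w], bounded by [d2], plus
     the suspension of [w - push (subdiv w)], bounded by [d1]. *)
  exists (d2 + d1); first exact: rpredD.
  rewrite (raddfMz (push _)) suspMz -mulrzA -expr2 sqrr_sign mulr1z [RHS]raddfD /=.
  by rewrite -e1 -e2 -e suspensionB addrA subrK.
rewrite -[h]hreprK; case: (hrepr h) => c hc; rewrite PsiE PhiE.
apply/esym/hclass_eq => /=; rewrite /G /flag_part !raddfMz /=.
rewrite -mulrzA -expr2 sqrr_sign mulr1z (desuspensionK x0 (push_cycle _ hc)).
exact: subdiv_push_homologous.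
Qed.

(** An equality of chains: only the term [g] of the symbol avoids 0, and the sign of
    [subdiv_bd_perm] cancels that of [flag_part]. *)
Lemma flag_part_ext_symbol (hn : (1 < \dim {:V})%N) (g : (\dim {:V}).-tuple V)
    (hg : forall i, tnth g i != 0) :
  flag_part (\dim {:V}).-1 (ext_symbol_chain g) =
  push (modular_map hg) (fund_chain (\dim {:V})).
Proof.
rewrite /flag_part.
have -> : nonzero_part (ext_symbol_chain g) = gen (tval g).
  rewrite raddfD /= nonzero_part_gen ifN; last first.
    by apply/tnthP => -[i /esym/eqP]; apply/negP.
  rewrite nonzero_part_eq0 ?addr0 //; apply: rpred_sum => i _.
  by apply/rpredMz/within_gen; rewrite /= mem_head.
have sg : size g = (\dim {:V}).-1.+1 by rewrite size_tuple (prednK (ltnW hn)).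
rewrite (subdiv_bd_perm sg) -mulrzA -expr2 sqrr_sign mulr1z (prednK (ltnW hn)).
rewrite [RHS]raddf_sum; apply: eq_bigr => sigma _; rewrite raddfMz /= push_gen.
rewrite /perm_flag -map_comp; congr (gen _ *~ _); apply: eq_map => k.
by rewrite /= perm_span_of.
Qed.

Lemma estar_ext_symbol0 (hn : (1 < \dim {:V})%N) (M : zmodType)
    (D : {additive rhomology (estar V) (\dim {:V}).-1 -> M}) :
  (forall g (hg : forall i, tnth g i != 0), D (ext_symbol hn hg) = 0) ->
  forall h, D h = 0.
Proof.
move=> Dg h; rewrite -[h]hreprK; case: (hrepr h) => z hz.
have n0 := ltnW hn.
have D0 : D (hclass 0) = 0.
  by rewrite -(subrr (0 : cycle (estar V) (\dim {:V}).-1)) hclassB raddfB subrr.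
(* For a cycle [z] one has [z = bd (cone 0 z)]. The new claim makes sense for every chain [z] and is
   additive, so it can be checked on single simplices. *)
suff [y yE <-] : exists2 y : cycle (estar V) (\dim {:V}).-1,
    val y = bd (cone 0 z) & D (hclass y) = 0.
  congr (D (hclass _)); apply: val_inj; rewrite yE bd_cone.
  by have /andP[_ /eqP->] := hz; rewrite raddf0 subr0.
have /andP[+ _] := hz; elim/within_ind=> [s|c d [y yE y0] [y' yE' y0']|]; last 2 first.
- by exists (y - y'); rewrite /= ?yE ?yE' ?hclassB !raddfB //= y0 y0' subrr.
- by exists 0; rewrite ?raddf0.
rewrite osimplex_estar (prednK n0) => /andP[sn sV].
have [s0|s0] := boolP (0 \in s).
  (* Here [0 :: s] is itself a simplex of E^*(V), so its boundary has class zero; otherwise [s] is a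
     tuple of non-zero vectors and the boundary is an extended symbol. *)
  have hd : gen (0 :: s) \in chain (estar V) (\dim {:V}).-1.+1.
    rewrite chain_gen // osimplex_estar /= (eqP sn) (prednK n0) eqxx.
    by rewrite span_cons0 (implyP sV s0) implybT.
  have bd_cycle : bd (gen (0 :: s)) \in is_cycle (estar V) (\dim {:V}).-1.
    rewrite inE bd_bd eqxx andbT; apply: bd_within hd => t i ht ti.
    rewrite osimplex_estar size_face //; move: ht; rewrite osimplex_estar.
    case/andP=> /eqP-> tV; rewrite eqxx; apply/implyP => /mem_face t0.
    exact: span_neq_sub (@mem_face _ i t) (implyP tV t0).
  exists (Cycle bd_cycle); first by rewrite /= cone_gen.
  have -> : hclass (Cycle bd_cycle) = hclass 0.
    by apply/hclass_eq; exists (gen (0 :: s)); rewrite //= subr0.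
  exact: D0.
pose g := Tuple sn.
have hg i : tnth g i != 0.
  by apply: contraNneq s0 => <-; apply: mem_tnth.
exists (Cycle (ext_symbol_is_cycle hn hg)); last exact: Dg.
by rewrite /= ext_symbol_chainE cone_gen.
Qed.

End Isomorphism.

Theorem theorem4p15 (K : fieldType) (V : vectType K) (hn : (1 < \dim {:V})%N) :
  exists Phi : {additive rhomology (estar V) (\dim {:V}).-1 -> steinberg V},
    [/\ forall (g : (\dim {:V}).-tuple V) (hg : forall i, tnth g i != 0),
          Phi (ext_symbol hn hg) = modular_symbol hn hg,
        forall Psi : {additive rhomology (estar V) (\dim {:V}).-1 -> steinberg V},
          (forall (g : (\dim {:V}).-tuple V) (hg : forall i, tnth g i != 0),
             Psi (ext_symbol hn hg) = modular_symbol hn hg) ->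
          Psi =1 Phi
      & bijective Phi].
Proof.
have [x x0] : exists x : V, x != 0.
  exists (vpick {:V}); rewrite vpick0; apply: contraTneq hn => ->.
  by rewrite dimv0.
have [Phi Phi_bij PhiE] : exists2 Phi :
    {additive rhomology (estar V) (\dim {:V}).-1 -> steinberg V}, bijective Phi &
    forall g (hg : forall i, tnth g i != 0),
      Phi (ext_symbol hn hg) = modular_symbol hn hg.
  have pE : (\dim {:V}).-1 = (\dim {:V}).-2.+1 by lia.
  have [Phi Phi_bij PhiE] := homology_estar_tits (\dim {:V}).-1 pE x0.
  exists Phi => // g hg; rewrite PhiE /modular_symbol hpush_hclass; congr hclass.
  by apply: val_inj; apply: flag_part_ext_symbol.
exists Phi; split=> // Psi PsiE h.
apply/eqP; rewrite -subr_eq0; apply/eqP.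
apply: (estar_ext_symbol0 (D := Psi \- Phi)) => g hg /=.
by rewrite PsiE PhiE subrr.
Qed.
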